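(* Let $X$ be a real Banach space. If the Lipschitz-free space $F(X)$ has the approximation property, then $X$ has the Lipschitz approximation property.
   Context: $Lip_0(X,Y)$ is the space of Lipschitz maps $f:X\to Y$ with $f(0)=0$, and $X^{\#}=Lip_0(X,\mathbb{R})$ is a Banach space under the best-Lipschitz-constant norm. The Lipschitz-free space is $F(X)=\overline{\mathrm{span}}^{\|\cdot\|}\{\delta_x:x\in X\}\subset (X^{\#})^*$, where $\delta_x(f)=f(x)$. $Lip_{0\mathcal{F}}(X,X)$ is the set of $f\in Lip_0(X,X)$ whose range spans a finite-dimensional subspace. $\tau_c$ is the topology of uniform convergence on compact subsets. A Banach space $E$ has the approximation property if $Id_E$ lies in the $\tau_c$-closure of the bounded finite-rank linear operators on $E$; $X$ has the Lipschitz approximation property if $Id_X\in\overline{Lip_{0\mathcal{F}}(X,X)}^{\tau_c}$. *)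

(* Defs.v *)
From HB Require Import structures.
From mathcomp Require Import all_boot all_order all_algebra.
From mathcomp Require Import boolp classical_sets functions reals.
From mathcomp Require Import topology normedtype.

Set Implicit Arguments.
Unset Strict Implicit.
Unset Printing Implicit Defensive.

Import Order.TTheory GRing.Theory Num.Theory.
Import numFieldNormedType.Exports.

Local Open Scope classical_set_scope.
Local Open Scope ring_scope.

Section lspan.
Context {R : nzRingType} {V : lmodType R}.

Definition lspan (A : set V) : set V :=
  [set v | exists n (a : 'I_n -> R) (e : 'I_n -> V),
     (forall i, A (e i)) /\ v = \sum_(i < n) a i *: e i].

(* [e] is not required to be free, so this is "finitely generated". *)
Definition finite_dim (A : set V) :=
  exists n (e : 'I_n -> V), A = lspan (range e).

Lemma lspan0 (A : set V) : lspan A 0.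
Proof.
exists 0%N, (fun=> 0), (fun=> 0); split; first by case.
by rewrite big_ord0.
Qed.

Lemma lspanZD (A : set V) (k : R) (u v : V) :
  lspan A u -> lspan A v -> lspan A (k *: u + v).
Proof.
move=> [m [a [e [Ae ->]]]] [n [b [f [Af ->]]]].
exists (m + n)%N,
  (fun i => match fintype.split i with inl j => k * a j | inr j => b j end),
  (fun i => match fintype.split i with inl j => e j | inr j => f j end); split.
  by move=> i; case: fintype.split.
rewrite big_split_ord/= scaler_sumr; congr (_ + _); apply: eq_bigr => i _.
  by rewrite (unsplitK (inl i)) scalerA.
by rewrite (unsplitK (inr i)).
Qed.

End lspan.

Lemma sup_ge0 (R : realType) (A : set R) : (forall x, A x -> 0 <= x) -> 0 <= sup A.
Proof.
move=> A0; have [[[a Aa] ubA]|/sup_out->//] := pselect (has_sup A).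
by rewrite (le_trans (A0 _ Aa))// ub_le_sup.
Qed.

Section Lip0.
Context {R : realType} (X Y : normedModType R).

Definition is_lip0 (f : X -> Y) : Prop := lipschitz f /\ f 0 = 0.

Definition lip0_pred : {pred X -> Y} := [pred f | `[< is_lip0 f >]].

Record lip0 : Type := Lip0 {
  lip0_fun :> X -> Y;
  lip0_funP : lip0_fun \in lip0_pred }.

HB.instance Definition _ := [isSub for lip0_fun].
HB.instance Definition _ := [Choice of lip0 by <:].

Lemma lipschitz_ex (f : X -> Y) : lipschitz f ->
  exists2 k, 0 <= k & forall x y, `|f x - f y| <= k * `|x - y|.
Proof.
move=> /pinfty_ex_gt0[k k0 fk]; exists k; first exact: ltW.
by move=> x y; exact: (fk (x, y)).
Qed.

Lemma ex_lipschitz (f : X -> Y) (k : R) :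
  (forall x y, `|f x - f y| <= k * `|x - y|) -> lipschitz f.
Proof.
move=> fk; apply: (@klipschitzW _ _ _ k); last by move=> [x y] _; exact: fk.
exact: (@globally_properfilter _ _ (0, 0)).
Qed.

Lemma lip0_submod_closed : submod_closed lip0_pred.
Proof.
split; first by apply/asboolP; split=> //; apply: (@ex_lipschitz _ 0) => x y;
  rewrite subrr normr0 mul0r.
move=> k f g /asboolP[/lipschitz_ex[a a0 fa] f0] /asboolP[/lipschitz_ex[b b0 gb] g0].
apply/asboolP; split; last by rewrite !fctE f0 g0 addr0 scaler0.
apply: (@ex_lipschitz _ (`|k| * a + b)) => x y; rewrite !fctE.
rewrite opprD addrACA -scalerBr (le_trans (ler_normD _ _))// mulrDl lerD//.
by rewrite normrZ -mulrA ler_wpM2l.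
Qed.

HB.instance Definition _ := GRing.isSubmodClosed.Build R (X -> Y) lip0_pred
  lip0_submod_closed.
HB.instance Definition _ := [SubChoice_isSubLmodule of lip0 by <:].

(* [sup set0 = 0], so the zero space is covered. *)
Definition lip_norm (f : X -> Y) : R :=
  sup [set `|f p.1 - f p.2| / `|p.1 - p.2| | p in [set p : X * X | p.1 != p.2]].

Lemma lip_norm_le (f : X -> Y) (k : R) : 0 <= k ->
  (forall x y, `|f x - f y| <= k * `|x - y|) -> lip_norm f <= k.
Proof.
move=> k0 fk; rewrite /lip_norm; set A := (X in sup X).
have [->|/set0P A0] := eqVneq A set0; first by rewrite sup0.
apply: ge_sup => // _ [[x y]/= xy <-].
by rewrite ler_pdivrMr ?normr_gt0 ?subr_eq0.
Qed.

Lemma lip_normP (f : X -> Y) : lipschitz f ->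
  forall x y, `|f x - f y| <= lip_norm f * `|x - y|.
Proof.
move=> /lipschitz_ex[k k0 fk] x y.
have [->|xy] := eqVneq x y; first by rewrite !subrr !normr0 mulr0.
rewrite -ler_pdivrMr ?normr_gt0 ?subr_eq0//.
apply: ub_le_sup; last by exists (x, y).
by exists k => _ [[u v]/= uv <-]; rewrite ler_pdivrMr ?normr_gt0 ?subr_eq0.
Qed.

Lemma lip_norm_ge0 (f : X -> Y) : 0 <= lip_norm f.
Proof.
by apply: sup_ge0 => _ [p _ <-]; rewrite divr_ge0.
Qed.

Lemma lip0_lipschitz (f : lip0) : lipschitz f.
Proof. by have /asboolP[] := lip0_funP f. Qed.

Lemma lip0_0 (f : lip0) : f 0 = 0.
Proof. by have /asboolP[] := lip0_funP f. Qed.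

Lemma lip0_normD (f g : lip0) : lip_norm (f + g) <= lip_norm f + lip_norm g.
Proof.
apply: lip_norm_le; first by rewrite addr_ge0// lip_norm_ge0.
move=> x y; rewrite /= !fctE opprD addrACA (le_trans (ler_normD _ _))// mulrDl.
by rewrite lerD// lip_normP//; exact: lip0_lipschitz.
Qed.

Lemma lip0_normZ (k : R) (f : lip0) : lip_norm (k *: f) = `|k| * lip_norm f.
Proof.
have le_k (a : R) (g : lip0) : lip_norm (a *: g) <= `|a| * lip_norm g.
  apply: lip_norm_le; first by rewrite mulr_ge0// lip_norm_ge0.
  move=> x y; rewrite /= !fctE -scalerBr normrZ -mulrA ler_wpM2l//.
  by apply: lip_normP; exact: lip0_lipschitz.
apply/eqP; rewrite eq_le le_k/=.
have [->|k0] := eqVneq k 0; first by rewrite normr0 mul0r lip_norm_ge0.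
rewrite mulrC -ler_pdivlMr ?normr_gt0// mulrC -normfV.
by rewrite -{1}(scale1r f) -(mulVf k0) -scalerA le_k.
Qed.

Lemma lip0_norm_eq0 (f : lip0) : lip_norm f = 0 -> f = 0.
Proof.
move=> f0; apply/val_inj/funext => x /=; apply/eqP.
rewrite -normr_le0 -[f x]subr0 -{1}(lip0_0 f).
by rewrite (le_trans (lip_normP (lip0_lipschitz f) _ _))// f0 mul0r.
Qed.

HB.instance Definition _ := Lmodule_isNormed.Build R lip0
  lip0_normD lip0_normZ lip0_norm_eq0.

Lemma ler_lip0_norm (f : lip0) (x y : X) : `|f x - f y| <= `|f| * `|x - y|.
Proof. exact: (lip_normP (lip0_lipschitz f)). Qed.

End Lip0.

Section dual.
Context {R : realType} (V : normedModType R).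

Definition dual_pred : {pred V -> R} :=
  [pred f | `[< linear (f : V -> R) /\ continuous f >]].

Record dual : Type := Dual {
  dual_fun :> V -> R;
  dual_funP : dual_fun \in dual_pred }.

HB.instance Definition _ := [isSub for dual_fun].
HB.instance Definition _ := [Choice of dual by <:].

Lemma dual_submod_closed : submod_closed (dual_pred : {pred V -> R}).
Proof.
split.
  apply/asboolP; split; first by move=> a x y; rewrite [RHS]addr0 scaler0.
  by move=> x; exact: cvg_cst.
move=> k f g /asboolP[lf cf] /asboolP[lg cg]; apply/asboolP; split.
  move=> a x y; rewrite !fctE lf lg !scalerDr !scalerA (mulrC k a).
  by rewrite -!addrA; congr (_ + _); rewrite addrCA.
move=> x; apply: cvgD; last exact: cg.
by apply: cvgZl_tmp; exact: cf.
Qed.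

HB.instance Definition _ := GRing.isSubmodClosed.Build R (V -> R) dual_pred
  dual_submod_closed.
HB.instance Definition _ := [SubChoice_isSubLmodule of dual by <:].

Lemma dual_linear (f : dual) : linear f.
Proof. by have /asboolP[] := dual_funP f. Qed.

Lemma dual_continuous (f : dual) : continuous f.
Proof. by have /asboolP[] := dual_funP f. Qed.
Arguments dual_continuous : clear implicits.

HB.instance Definition _ (f : dual) :=
  GRing.isLinear.Build R V R *:%R f (dual_linear f).

Definition dual_norm (f : V -> R) : R :=
  sup [set `|f x| | x in [set x | `|x| <= 1]].

Lemma dual_norm_le (f : V -> R) (k : R) : 0 <= k ->
  (forall x, `|f x| <= k * `|x|) -> dual_norm f <= k.
Proof.
move=> k0 fk; apply: ge_sup.
  by exists `|f 0|; exists 0 => //=; rewrite normr0.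
by move=> _ [x /= x1 <-]; rewrite (le_trans (fk x))// ler_piMr.
Qed.

Lemma dual_norm_ge0 (f : V -> R) : 0 <= dual_norm f.
Proof. by apply: sup_ge0 => _ [x _ <-]. Qed.

Lemma dual_bounded (f : dual) : exists2 k, 0 <= k & forall x, `|f x| <= k * `|x|.
Proof.
have /linear_bounded_continuous/linear_boundedP/pinfty_ex_gt0[k k0 fk] :=
  dual_continuous f.
by exists k => //; exact: ltW.
Qed.

Lemma dual_normP (f : dual) x : `|f x| <= dual_norm f * `|x|.
Proof.
have [->|x0] := eqVneq x 0; first by rewrite linear0 !normr0 mulr0.
rewrite -ler_pdivrMr ?normr_gt0//.
have [k k0 fk] := dual_bounded f.
apply: ub_le_sup.
  by exists k => _ [y /= y1 <-]; rewrite (le_trans (fk y))// ler_piMr.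
exists (`|x|^-1 *: x); first by rewrite /= normfZV.
by rewrite linearZ/= normrM normfV normr_id mulrC.
Qed.

Lemma dual_normD (f g : dual) : dual_norm (f + g) <= dual_norm f + dual_norm g.
Proof.
apply: dual_norm_le; first by rewrite addr_ge0// dual_norm_ge0.
move=> x; rewrite /= !fctE (le_trans (ler_normD _ _))// mulrDl.
by rewrite lerD// dual_normP.
Qed.

Lemma dual_normZ (k : R) (f : dual) : dual_norm (k *: f) = `|k| * dual_norm f.
Proof.
have le_k (a : R) (g : dual) : dual_norm (a *: g) <= `|a| * dual_norm g.
  apply: dual_norm_le; first by rewrite mulr_ge0// dual_norm_ge0.
  by move=> x; rewrite /= !fctE normrZ -mulrA ler_wpM2l// dual_normP.
apply/eqP; rewrite eq_le le_k/=.
have [->|k0] := eqVneq k 0; first by rewrite normr0 mul0r dual_norm_ge0.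
rewrite mulrC -ler_pdivlMr ?normr_gt0// mulrC -normfV.
by rewrite -{1}(scale1r f) -(mulVf k0) -scalerA le_k.
Qed.

Lemma dual_norm_eq0 (f : dual) : dual_norm f = 0 -> f = 0.
Proof.
move=> f0; apply/val_inj/funext => x /=; apply/eqP.
by rewrite -normr_le0 (le_trans (dual_normP _ _))// f0 mul0r.
Qed.

HB.instance Definition _ := Lmodule_isNormed.Build R dual
  dual_normD dual_normZ dual_norm_eq0.

Lemma ler_dual_norm (f : dual) (x : V) : `|f x| <= `|f| * `|x|.
Proof. exact: dual_normP. Qed.

Lemma dual_complete (F : set_system dual) : ProperFilter F -> cauchy F -> cvg F.
Proof.
move=> FF /cauchyP cF.
have Fcvg x : cvg ((fun f : dual => f x : R) @ F).
  apply: cauchy_cvg; apply/cauchyP => e e0 /=.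
  have [|f Ff] := cF (e / (1 + `|x|)); first by rewrite divr_gt0// ltr_pwDl.
  exists (f x); apply: filterS Ff => g; rewrite -!ball_normE/= => fg.
  rewrite (le_lt_trans (ler_dual_norm (f - g) x))//.
  rewrite (@le_lt_trans _ _ (`|f - g| * (1 + `|x|)))//.
    by rewrite ler_wpM2l// lerDr.
  by rewrite -ltr_pdivlMr// ltr_pwDl.
pose l x : R := lim ((fun f : dual => f x : R) @ F).
have lE x : (fun f : dual => f x : R) @ F --> l x by exact: Fcvg.
have llin : linear l.
  move=> a x y; apply: cvg_lim => //.
  rewrite (_ : (fun f : dual => _) = fun f : dual => a *: (f x : R) + f y).
    by apply: cvgD (lE y); apply: cvgZl_tmp (lE x).
  by apply/funext => f; rewrite linearP.
have near_l (f : dual) e : F (ball f e) -> forall x, `|f x - l x| <= e * `|x|.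
  move=> Ff x.
  have cvgx : (fun g : dual => `|f x - g x|) @ F --> `|f x - l x|.
    by apply: cvg_norm; apply: cvgB (lE x); exact: cvg_cst.
  apply: (cvgr_to_le cvgx); apply: (filterS _ Ff) => g.
  rewrite -ball_normE/= => /ltW fg.
  by rewrite (le_trans (ler_dual_norm (f - g) x))// ler_wpM2r.
have lcont : continuous l.
  pose L := GRing.isLinear.Build R V R *:%R l llin.
  pose lL : {linear V -> R} := HB.pack l L.
  have [f Ff] := cF 1 ltr01.
  apply: (@bounded_linear_continuous _ _ _ lL).
  apply/linear_boundedP; exists (1 + `|f|); split; first exact: num_real.
  move=> k k1 x.
  rewrite (@le_trans _ _ ((1 + `|f|) * `|x|))//; last by rewrite ler_wpM2r// ltW.
  rewrite -[lL x](subrK (f x)) (le_trans (ler_normD _ _))// mulrDl lerD//.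
    by rewrite distrC near_l.
  exact: ler_dual_norm.
have lP : l \in dual_pred by apply/asboolP.
apply/cvg_ex; exists (Dual lP); apply/cvg_ballP => e e0.
have e20 : 0 < e / 2 by rewrite divr_gt0.
have [f Ff] := cF _ e20.
apply: filterS (Ff) => g; rewrite -!ball_normE/= => fg.
rewrite (le_lt_trans (ler_distD f _ _))// (splitr e) ler_ltD//.
apply: dual_norm_le; first exact: ltW.
by move=> x; rewrite /= distrC near_l.
Qed.

HB.instance Definition _ := Uniform_isComplete.Build dual dual_complete.

End dual.

Section lipschitz_free.
Context {R : realType} (X : normedModType R).

Definition eval_at (x : X) (f : lip0 X R) : R := f x.

Lemma eval_at_dual (x : X) : eval_at x \in @dual_pred R (lip0 X R).
Proof.
have lx : linear (eval_at x) by [].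
apply/asboolP; split=> //.
pose L := GRing.isLinear.Build R (lip0 X R) R *:%R (eval_at x) lx.
pose dx : {linear lip0 X R -> R} := HB.pack (eval_at x) L.
apply: (@bounded_linear_continuous _ _ _ dx).
apply/linear_boundedP; exists `|x|; split; first exact: num_real.
move=> k xk f.
rewrite (@le_trans _ _ (`|x| * `|f|))//; last by rewrite ler_wpM2r// ltW.
rewrite mulrC -[dx f]subr0 -(lip0_0 f) -[X in _ * `|X|]subr0.
exact: ler_lip0_norm.
Qed.

Definition delta (x : X) : dual (lip0 X R) := Dual (eval_at_dual x).

Definition lip_free_pred : {pred dual (lip0 X R)} :=
  [pred m | `[< closure (lspan (range delta)) m >]].

(* The norm below is inherited from [dual (lip0 X R)]. *)
Record lip_free : Type := LipFree {
  lip_free_val :> dual (lip0 X R);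
  lip_free_valP : lip_free_val \in lip_free_pred }.

HB.instance Definition _ := [isSub for lip_free_val].
HB.instance Definition _ := [Choice of lip_free by <:].

Lemma lip_free_submod_closed : submod_closed lip_free_pred.
Proof.
split; first by apply/asboolP/subset_closure; exact: lspan0.
move=> k m n /asboolP cm /asboolP cn; apply/asboolP => B Bmn.
have : (fun z : dual (lip0 X R) * dual (lip0 X R) => k *: z.1 + z.2) @ (m, n)
    --> k *: m + n.
  by apply: cvgD; [apply: cvgZl_tmp; exact: cvg_fst|exact: cvg_snd].
move=> /(_ _ Bmn)[[M N] /= [mM nN] MNB].
have [u [Su Mu]] := cm _ mM; have [v [Sv Nv]] := cn _ nN.
exists (k *: u + v); split; first exact: lspanZD.
exact: (MNB (u, v)).
Qed.

HB.instance Definition _ := GRing.isSubmodClosed.Build R (dual (lip0 X R))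
  lip_free_pred lip_free_submod_closed.
HB.instance Definition _ := [SubChoice_isSubLmodule of lip_free by <:].

Definition lip_free_norm (m : lip_free) : R := `|val m|.

Lemma lip_free_normD m n :
  lip_free_norm (m + n) <= lip_free_norm m + lip_free_norm n.
Proof. exact: ler_normD. Qed.

Lemma lip_free_normZ k m : lip_free_norm (k *: m) = `|k| * lip_free_norm m.
Proof. exact: normrZ. Qed.

Lemma lip_free_norm_eq0 m : lip_free_norm m = 0 -> m = 0.
Proof. by move=> /normr0_eq0 m0; exact: val_inj. Qed.

HB.instance Definition _ := Lmodule_isNormed.Build R lip_free
  lip_free_normD lip_free_normZ lip_free_norm_eq0.

Lemma lip_free_complete (F : set_system lip_free) :
  ProperFilter F -> cauchy F -> cvg F.
Proof.
move=> FF /cauchyP cF.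
have /cvg_ex[m Fm] : cvg ((val : lip_free -> dual (lip0 X R)) @ F).
  apply: cauchy_cvg; apply/cauchyP => e e0.
  by have [f Ff] := cF e e0; exists (val f).
have mP : m \in lip_free_pred.
  apply/asboolP; apply: (closed_cvg _ _ _ m Fm); first exact: closed_closure.
  by apply: nearW => f; have /asboolP := lip_free_valP f.
apply/cvg_ex; exists (LipFree mP); apply/cvg_ballP => e e0.
by move/cvg_ballP : Fm => /(_ e e0).
Qed.

HB.instance Definition _ := Uniform_isComplete.Build lip_free lip_free_complete.

End lipschitz_free.

Section approximation_properties.
Context {R : realType}.

(* The topology of [{family compact, E -> E}] is that of uniform convergence on
   the compact subsets of [E]. *)
Definition tau_c_closure (E : normedModType R) (A : set (E -> E)) : set (E -> E) :=
  closure (A : set {family compact, E -> E}).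

Definition finite_rank_operators (E : normedModType R) : set (E -> E) :=
  [set T : E -> E | [/\ linear T, bounded_near T (nbhs (0 : E)) &
                     finite_dim (range T)]].

Definition approximation_property (E : completeNormedModType R) : Prop :=
  tau_c_closure (@finite_rank_operators E) idfun.

Definition lip0F (X : normedModType R) : set (X -> X) :=
  [set f : X -> X | is_lip0 f /\ finite_dim (lspan (range f))].

Definition lipschitz_approximation_property (X : completeNormedModType R) :
  Prop := tau_c_closure (@lip0F X) idfun.

End approximation_properties.

(* Main.v *)
Require Import Defs.
From HB Require Import structures.
From mathcomp Require Import all_boot all_order all_algebra.
From mathcomp Require Import boolp classical_sets functions reals.
From mathcomp Require Import topology normedtype.

(** The map [delta : X -> F(X)] is 1-Lipschitz and it has a linear left inverse of
    norm at most one, the barycenter map [b : F(X) -> X], determined by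
    [b (delta x) = x]. Composing with both turns a finite-rank operator [T] of
    [F(X)] into [b \o T \o delta : X -> X]: this map is Lipschitz, vanishes at 0
    and has its range in the finite-dimensional space [b (range T)]
    ([lip0F_compress]). If [T] is within [e] of the identity on the compact set
    [delta (K)], then [b \o T \o delta] is within [e] of [b \o delta], the
    identity of [X], on [K]. So the approximation property of [F(X)] passes to
    the Lipschitz approximation property of [X].

    The substance is the existence of [b] ([barycenter_ex]). On the span of the
    evaluations, [b] has to send [sum a_i delta_(x_i)] to [sum a_i x_i]; it is
    well defined and 1-Lipschitz there by the inequality
    [|sum a_i x_i| <= |sum a_i delta_(x_i)|] ([norm_sum_le_delta]), and it
    extends to the closure because [X] is complete.

    For this inequality one wants a 1-Lipschitz [q : X -> R] with [q 0 = 0] and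
    [sum a_i q (x_i) >= |sum a_i x_i|]. This is a finite form of the Hahn-Banach
    theorem: [q] has to behave linearly at the finitely many points [x_i], and
    its Lipschitz bound follows from subadditivity and [q <= |.|]. Such a [q] is obtained from the norm in
    finitely many steps, each of which makes a sublinear functional smaller and
    linear along one more direction ([sublinear_linear_on]). *)

Set Implicit Arguments.
Unset Strict Implicit.
Unset Printing Implicit Defensive.

Import Order.TTheory GRing.Theory Num.Theory.
Import numFieldNormedType.Exports.

Local Open Scope classical_set_scope.
Local Open Scope ring_scope.

(** * Sublinear functionals *)

Section sublinear_functionals.
Context {R : realType} {V : lmodType R}.
Implicit Types (q : V -> R) (x y : V) (t : R).

(** An inequality is enough for homogeneity: applying it to [t^-1] as well gives
    equality ([sublinearZ]). *)
Definition sublinear q : Prop :=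
  (forall x y, q (x + y) <= q x + q y) /\
  (forall t x, 0 <= t -> q (t *: x) <= t * q x).

Lemma sublinearZ q t x : sublinear q -> 0 <= t -> q (t *: x) = t * q x.
Proof.
move=> [qD qZ]; rewrite le_eqVlt => /predU1P[<-|t0].
  apply/le_anti; rewrite qZ//= scale0r mul0r.
  by have := qD 0 0; rewrite addr0 lerDl.
apply/le_anti/andP; split; first exact: qZ (ltW t0).
rewrite -ler_pdivlMl// -[X in q X <= _](scalerK (lt0r_neq0 t0)).
by rewrite qZ// invr_ge0 ltW.
Qed.

Lemma sublinear0 q : sublinear q -> q 0 = 0.
Proof. by move=> q_; have := sublinearZ 0 q_ (lexx 0); rewrite scale0r mul0r. Qed.

Lemma sublinear_ge q x : sublinear q -> - q (- x) <= q x.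
Proof.
move=> q_; rewrite -[- _]add0r lerBlDr -(sublinear0 q_) -(subrr x).
exact: q_.1.
Qed.

(** Where [q] is odd it is linear: a negative coefficient [a] can be moved into a
    positive multiple of [- e]. *)
Lemma sublinear_sum_le q n (a : 'I_n -> R) (e : 'I_n -> V) : sublinear q ->
  (forall i, q (- e i) <= - q (e i)) ->
  q (\sum_(i < n) a i *: e i) <= \sum_(i < n) a i * q (e i).
Proof.
move=> q_ qe; elim/big_ind2: _ => [|x s y t qx qy|i _].
- by rewrite sublinear0.
- by rewrite (le_trans (q_.1 _ _))// lerD.
- have [a0|/ltW a0] := leP 0 (a i); first exact: q_.2.
  rewrite -[a i *: _]opprK -scaleNr -scalerN.
  rewrite (le_trans (q_.2 _ _ _)) ?oppr_ge0// -[leRHS]mulrNN.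
  by rewrite ler_wpM2l ?oppr_ge0.
Qed.

(** The next construction is the step of the Hahn-Banach theorem: among the
    sublinear functionals below [q], it produces one that is linear along the
    line through [y], with the value [q y] kept at [y]. *)
Section linearize.
Variables (q : V -> R) (y : V).
Hypothesis q_ : sublinear q.

(* The expressions are nonincreasing in [t], so their infimum is the limit of
   [q (x + t *: y) - t * q y] as [t] tends to infinity. *)
Let slopes x : set R := [set q (x + t *: y) - t * q y | t in [set t | 0 <= t]].

Let slopes_nonempty x : slopes x !=set0.
Proof. by exists (q (x + 0 *: y) - 0 * q y), 0 => /=. Qed.

Let slopes_lbound x : lbound (slopes x) (- q (- x)).
Proof.
move=> _ [t /= t0 <-]; rewrite lerBrDr addrC lerBlDr -sublinearZ//.
by rewrite -[X in q X <= _](addrK x) [t *: y + x]addrC; exact: q_.1.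
Qed.

Let has_inf_slopes x : has_inf (slopes x).
Proof. by split=> //; exists (- q (- x)). Qed.

Definition linearize x : R := inf (slopes x).

Lemma linearize_le t x : 0 <= t -> linearize x <= q (x + t *: y) - t * q y.
Proof. by move=> t0; apply: ge_inf; [exact: (has_inf_slopes x).2|exists t]. Qed.

Lemma linearize_ge x r : (forall t, 0 <= t -> r <= q (x + t *: y) - t * q y) ->
  r <= linearize x.
Proof. by move=> rq; apply: lb_le_inf => // _ [t t0 <-]; exact: rq. Qed.

Lemma linearize_le_self x : linearize x <= q x.
Proof. by rewrite (le_trans (linearize_le x (lexx 0)))// scale0r addr0 mul0r subr0. Qed.

Lemma linearizeN : linearize (- y) <= - q y.
Proof.
rewrite (le_trans (linearize_le (- y) ler01))//.
by rewrite scale1r addNr sublinear0// mul1r sub0r.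
Qed.

Lemma sublinear_linearize : sublinear linearize.
Proof.
split=> [x z|s x].
  rewrite -lerBlDl; apply: linearize_ge => t t0; rewrite lerBlDr -lerBlDl.
  apply: linearize_ge => s s0; rewrite lerBlDl.
  rewrite (le_trans (linearize_le _ (addr_ge0 s0 t0)))//.
  rewrite addrACA -opprD -mulrDl [X in _ <= _ - X * _]addrC lerD2r//.
  by rewrite scalerDl addrACA [leRHS]addrC q_.1.
rewrite le_eqVlt => /predU1P[<-|s0].
  by rewrite scale0r mul0r (le_trans (linearize_le_self 0))// sublinear0.
rewrite -ler_pdivrMl//; apply: linearize_ge => t t0; rewrite ler_pdivrMl//.
rewrite (le_trans (linearize_le _ (mulr_ge0 (ltW s0) t0)))//.
by rewrite -scalerA -scalerDr (sublinearZ _ q_ (ltW s0)) -mulrA -mulrBr.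
Qed.

End linearize.

(** Oddness at a point survives later steps: if [p] is odd at [z] and [p' <= p] is
    sublinear, then [p' (- z) <= p (- z) <= - p z <= - p' z]. So the directions
    can be treated one after the other. *)
Lemma sublinear_linear_on q (s : seq V) : sublinear q ->
  exists q', [/\ sublinear q', forall x, q' x <= q x &
                 forall y, y \in s -> q' (- y) <= - q' y].
Proof.
move=> q_; elim: s => [|y s]; first by exists q.
case=> p [p_ pq ps].
exists (linearize p y); split; first exact: sublinear_linearize.
  by move=> x; rewrite (le_trans (linearize_le_self _ p_ _)).
move=> z; rewrite inE => /predU1P[->|zs].
  by rewrite (le_trans (linearizeN y p_))// lerN2 linearize_le_self.
rewrite (le_trans (linearize_le_self _ p_ _))// (le_trans (ps z zs))// lerN2.
exact: linearize_le_self.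
Qed.

End sublinear_functionals.

(** * Molecules dominate their barycenters *)

Lemma dual_sumE {R : realType} (V : normedModType R) n (a : 'I_n -> R)
    (m : 'I_n -> dual V) (v : V) :
  (\sum_(i < n) a i *: m i : dual V) v = \sum_(i < n) a i * m i v.
Proof. by rewrite (big_morph (fun f : dual V => f v) (id1 := 0) (op1 := +%R)). Qed.

Section norm_sum.
Context {R : realType} (X : normedModType R).

Lemma sublinear_norm : sublinear (fun x : X => `|x|).
Proof.
by split=> [x y|t x t0]; [exact: ler_normD|rewrite normrZ ger0_norm].
Qed.

(** A sublinear functional below the norm is a competitor in the norm of [F(X)],
    even though it need not be linear on all of [X]. *)
Lemma sublinear_lipschitz (q : X -> R) : sublinear q ->
  (forall x, q x <= `|x|) -> forall x y, `|q x - q y| <= 1 * `|x - y|.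
Proof.
move=> q_ qle x y; rewrite mul1r.
have qB z w : q z - q w <= `|z - w|.
  by rewrite lerBlDr -{1}(subrK w z) (le_trans (q_.1 _ _))// lerD2r.
by rewrite ler_norml qB lerNl opprB distrC qB.
Qed.

(** The norm is first linearized along the barycenter [y] itself, which makes the
    final functional equal to [|y|] at [y], and only then along the [x i]. *)
Lemma norm_sum_le_delta n (a : 'I_n -> R) (x : 'I_n -> X) :
  `|\sum_(i < n) a i *: x i| <= `|\sum_(i < n) a i *: delta (x i)|.
Proof.
set y := \sum_(i < n) _.
pose p := linearize (fun x : X => `|x|) y.
have p_ : sublinear p by exact: sublinear_linearize sublinear_norm.
have [q [q_ qp qx]] := sublinear_linear_on (codom x) p_.
have qle z : q z <= `|z|.
  by rewrite (le_trans (qp z))// linearize_le_self//; exact: sublinear_norm.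
have qlip := sublinear_lipschitz q_ qle.
have qP : q \in @lip0_pred R X R.
  by apply/asboolP; split; [exact: ex_lipschitz qlip|exact: sublinear0].
have yq : `|y| <= q y.
  rewrite (le_trans _ (sublinear_ge y q_))// lerNr (le_trans (qp _))//.
  exact: linearizeN sublinear_norm.
rewrite (le_trans yq)//.
rewrite (le_trans (sublinear_sum_le _ q_ _))//.
  by move=> i; rewrite qx// codom_f.
have -> : \sum_(i < n) a i * q (x i) =
    (\sum_(i < n) a i *: delta (x i) : dual _) (Lip0 qP).
  by rewrite dual_sumE.
rewrite (le_trans (ler_norm _))// (le_trans (ler_dual_norm _ _))//.
by rewrite ler_piMr//; exact: lip_norm_le qlip.
Qed.

End norm_sum.

(** * The barycenter map *)

Lemma sub_lspan {R : nzRingType} {V : lmodType R} (A : set V) : A `<=` lspan A.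
Proof.
by move=> x Ax; exists 1%N, (fun=> 1), (fun=> x); rewrite big_ord1 scale1r.
Qed.

Section barycenter.
Context {R : realType}.

Lemma closure_lspanZD (V : normedModType R) (A : set V) (k : R) (u v : V) :
  closure (lspan A) u -> closure (lspan A) v -> closure (lspan A) (k *: u + v).
Proof.
move=> cu cv B Buv.
have : (fun z : V * V => k *: z.1 + z.2) @ (u, v) --> k *: u + v.
  by apply: cvgD; [apply: cvgZl_tmp; exact: cvg_fst|exact: cvg_snd].
move=> /(_ _ Buv)[[M N] /= [uM vN] MNB].
have [u' [Su Mu]] := cu _ uM; have [v' [Sv Nv]] := cv _ vN.
exists (k *: u' + v'); split; first exact: lspanZD.
exact: (MNB (u', v')).
Qed.

Variable X : completeNormedModType R.
Local Notation dualL := (dual (lip0 X R)).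

(** The graph of the barycenter map on the span of the evaluations, taken as a
    subspace of the product: the map is then extended by taking the closure of
    its graph, so that linearity and the norm bound pass to the limit at once. *)
Definition bary_graph : set (dualL * X) := lspan (range (fun x => (delta x, x))).

Lemma bary_graph_norm z : bary_graph z -> `|z.2| <= `|z.1|.
Proof.
move=> [n [a [e [eE ->]]]].
have xP i : {x | e i = (delta x, x)} by apply/cid; have [x _ <-] := eE i; exists x.
rewrite (raddf_sum snd) (raddf_sum fst) /=.
have -> : \sum_(i < n) (a i *: e i).2 = \sum_(i < n) a i *: sval (xP i).
  by apply: eq_bigr => i _; rewrite {1}(svalP (xP i)).
have -> : \sum_(i < n) (a i *: e i).1 = \sum_(i < n) a i *: delta (sval (xP i)).
  by apply: eq_bigr => i _; rewrite {1}(svalP (xP i)).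
exact: norm_sum_le_delta.
Qed.

Lemma closure_bary_graph_norm z : closure bary_graph z -> `|z.2| <= `|z.1|.
Proof.
rewrite closureEcvg; case: z => m x [G GF [Gmx GG]] /=.
have cG : (fun w => `|w.1| - `|w.2|) @ G --> `|m| - `|x|.
  by apply: cvgB; apply: cvg_norm;
    [exact: (cvg_comp id _ Gmx cvg_fst)|exact: (cvg_comp id _ Gmx cvg_snd)].
rewrite -subr_ge0; apply: (cvgr_to_ge cG); apply: GG => w /bary_graph_norm.
by rewrite subr_ge0.
Qed.

Lemma bary_graph_total m : lspan (range (@delta R X)) m ->
  exists x, bary_graph (m, x).
Proof.
move=> [n [a [e [eE ->]]]].
have xP i : {x | delta x = e i} by apply/cid; have [x _ <-] := eE i; exists x.
exists (\sum_(i < n) a i *: sval (xP i)).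
exists n, a, (fun i => (e i, sval (xP i))); split.
  by move=> i; exists (sval (xP i)) => //; rewrite (svalP (xP i)).
by apply: injective_projections; rewrite raddf_sum.
Qed.

(** The barycenters of elements tending to [m] form a Cauchy filter by
    [bary_graph_norm]; this is where completeness of [X] enters. *)
Lemma closure_bary_graph_total m : closure (lspan (range (@delta R X))) m ->
  exists x, closure bary_graph (m, x).
Proof.
rewrite closureEcvg => -[G GF [Gm GG]].
have GS : G (lspan (range (@delta R X))) by apply: GG => u.
have /choice[b bP] : forall u, exists x, lspan (range (@delta R X)) u ->
    bary_graph (u, x).
  move=> u.
  have [/bary_graph_total[x ux]|] := pselect (lspan (range (@delta R X)) u).
    by exists x.
  by exists 0.
have : cvg (b @ G).
  apply: cauchy_cvg; apply/cauchyP => e e0.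
  have Gm2 : G (ball m (e / 2)) by apply: Gm; apply: nbhsx_ballx; rewrite divr_gt0.
  have [u [Su mu]] := filter_ex (filterI GS Gm2).
  exists (b u); change (G (b @^-1` ball (b u) e)).
  apply: filterS (filterI GS Gm2) => v [Sv mv].
  have := lspanZD (-1) (bP _ Sv) (bP _ Su) => /bary_graph_norm/=.
  rewrite !scaleN1r !(addrC (- _)) -ball_normE/= => /le_lt_trans; apply.
  by have := ball_splitr mu mv; rewrite -ball_normE.
move=> /cvg_ex[x bx]; exists x; rewrite closureEcvg.
exists ((fun u => (u, b u)) @ G); first exact: fmap_proper_filter.
split; first exact: (cvg_pair (f := id) Gm bx).
move=> P GP; change (G ((fun u => (u, b u)) @^-1` P)).
by apply: filterS GS => u Su; exact: GP (bP _ Su).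
Qed.

Lemma lip_free_delta (x : X) : delta x \in @lip_free_pred R X.
Proof.
by apply/asboolP/subset_closure/sub_lspan; exists x.
Qed.

Definition free_delta (x : X) : lip_free X := LipFree (lip_free_delta x).

Lemma free_delta_lipschitz x y : `|free_delta x - free_delta y| <= `|x - y|.
Proof. by apply: dual_norm_le => // f; rewrite mulrC; exact: ler_lip0_norm. Qed.

(** The norm bound on the closed graph, applied to differences, shows that it is
    the graph of a function. *)
Lemma barycenter_ex : exists b : lip_free X -> X,
  [/\ linear b, forall m, `|b m| <= `|m| & forall x, b (free_delta x) = x].
Proof.
have /choice[b bP] (m : lip_free X) :
    exists x, closure bary_graph (lip_free_val m, x).
  by apply: closure_bary_graph_total; exact/asboolP/(lip_free_valP m).
have unique m x y : closure bary_graph (m, x) -> closure bary_graph (m, y) ->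
    x = y.
  move=> mx my; apply/subr0_eq/normr0_eq0/le_anti; rewrite normr_ge0 andbT.
  have := closure_bary_graph_norm (closure_lspanZD (k := -1) my mx).
  by rewrite /= !scaleN1r addNr normr0 addrC.
exists b; split.
- move=> k m n; apply: (unique _ _ _ (bP _)).
  exact: closure_lspanZD (bP m) (bP n).
- by move=> m; exact: closure_bary_graph_norm (bP m).
- move=> x; apply: (unique _ _ _ (bP _)); apply: subset_closure.
  by apply: sub_lspan; exists x.
Qed.

End barycenter.

(** * Subsets of finitely generated spans *)

Section finitely_generated.

Lemma lspan_sub {R : nzRingType} {V : lmodType R} (A B : set V) :
  A `<=` lspan B -> lspan A `<=` lspan B.
Proof.
move=> AB _ [n [a [e [Ae ->]]]]; elim/big_ind: _ => [|u v Bu Bv|i _].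
- exact: lspan0.
- by rewrite -[u]scale1r; exact: lspanZD.
- by rewrite -[_ *: _]addr0; apply: lspanZD (lspan0 _); exact: AB.
Qed.

(** Rows taken from [C] with the largest possible rank generate [C], since
    adjoining a row outside their span would increase the rank. *)
Lemma row_generators (F : fieldType) n (C : set 'rV[F]_n) :
  exists r (M : 'M[F]_(r, n)),
    (forall i, C (row i M)) /\ forall c, C c -> (c <= M)%MS.
Proof.
pose good r := `[< exists k (M : 'M[F]_(k, n)),
  (forall i, C (row i M)) /\ \rank M = r >].
have good_ex : exists r, good r.
  by exists 0%N; apply/asboolP; exists 0%N, 0; split; [case|exact: mxrank0].
have good_le r : good r -> (r <= n)%N.
  by move=> /asboolP[k [M [_ <-]]]; exact: rank_leq_col.
have [r /asboolP[k [M [CM rM]]] r_max] := ex_maxnP good_ex good_le.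
exists k, M; split=> // c Cc; apply: contrapT => /negP cM.
suff /r_max : good (\rank (col_mx M c)).
  rewrite leqNgt -rM -addsmxE => /negP[].
  rewrite ltn_neqAle mxrankS ?addsmxSl// andbT.
  by rewrite mxrank_leqif_sup ?addsmxSl// addsmx_sub submx_refl.
apply/asboolP; exists (k + 1)%N, (col_mx M c); split=> // i.
rewrite -(splitK i); case: (fintype.split i) => j /=; first by rewrite rowKu.
by rewrite rowKd (_ : row j c = c)//; apply/rowP => l; rewrite mxE ord1.
Qed.

(** A subspace of a finitely generated space is finitely generated. The vectors
    [e i] may be dependent, so [A] is replaced by the set of all coordinate rows
    of its elements. *)
Lemma finite_dim_lspan (F : fieldType) (V : lmodType F) n (e : 'I_n -> V)
    (A : set V) : A `<=` lspan (range e) -> finite_dim (lspan A).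
Proof.
move=> Ae.
pose comb (c : 'rV[F]_n) : V := \sum_(i < n) c 0 i *: e i.
have combP v : A v -> exists c, v = comb c.
  move=> /Ae[m [a [f [fe ->]]]].
  have fP j : {i | e i = f j} by apply/cid; have [i _ <-] := fe j; exists i.
  exists (\sum_(j < m) a j *: delta_mx 0 (sval (fP j))).
  rewrite /comb.
  under [RHS]eq_bigr do rewrite summxE scaler_suml.
  rewrite exchange_big/=; apply: eq_bigr => j _.
  rewrite (bigD1 (sval (fP j)))//= big1 ?addr0.
    by rewrite !mxE !eqxx mulr1 (svalP (fP j)).
  by move=> i /negPf ij; rewrite !mxE eqxx ij mulr0 scale0r.
have [k [M [CM Msub]]] := row_generators [set c | A (comb c)].
exists k, (fun j => comb (row j M)); apply/seteqP; split.
  apply: lspan_sub => v Av; have [c cE] := combP _ Av.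
  have /submxP[u uE] : (c <= M)%MS by apply: Msub; rewrite /= -cE.
  exists k, (u 0), (fun j => comb (row j M)); split=> //.
  rewrite cE /comb uE; under [RHS]eq_bigr do rewrite scaler_sumr.
  rewrite exchange_big; apply: eq_bigr => i _ /=.
  rewrite mxE scaler_suml; apply: eq_bigr => j _.
  by rewrite mxE scalerA.
by apply: lspan_sub => _ [j _ <-]; apply: sub_lspan; exact: CM.
Qed.

End finitely_generated.

(** * From operators on the free space to Lipschitz maps *)

Section compression.
Context {R : realType}.

Lemma finite_rank_lipschitz (E : normedModType R) (T : E -> E) :
  finite_rank_operators T -> lipschitz T.
Proof.
move=> [lT bT _]; pose L := GRing.isLinear.Build R E E *:%R T lT.
pose lT' : {linear E -> E} := HB.pack T L.
have /linear_boundedP/pinfty_ex_gt0[k k0 Tk] : bounded_near lT' (nbhs 0) by [].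
apply: (@ex_lipschitz _ _ _ _ k) => x y.
by rewrite -[T x - T y](linearB lT') Tk.
Qed.

Variables (X : completeNormedModType R) (b : lip_free X -> X).
Hypotheses (b_linear : linear b) (b_norm : forall m, `|b m| <= `|m|).

Lemma barycenter_lipschitz m n : `|b m - b n| <= `|m - n|.
Proof.
have := b_linear (-1) n m; rewrite !scaleN1r !(addrC (- _)) => <-.
exact: b_norm.
Qed.

(** [b] carries the finite-dimensional range of [T] onto a finitely generated
    space, which contains the range of the composite. *)
Lemma lip0F_compress (T : lip_free X -> lip_free X) :
  finite_rank_operators T -> lip0F (fun x => b (T (free_delta x))).
Proof.
move=> Tfr; have [lT _ [n [e eT]]] := Tfr.
pose L := GRing.isLinear.Build R _ _ *:%R T lT.
pose T' : {linear lip_free X -> lip_free X} := HB.pack T L.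
pose Lb := GRing.isLinear.Build R _ _ *:%R b b_linear.
pose b' : {linear lip_free X -> X} := HB.pack b Lb.
split; first split.
- have [k k0 Tk] := lipschitz_ex (finite_rank_lipschitz Tfr).
  apply: (@ex_lipschitz _ _ _ _ k) => x y.
  rewrite (le_trans (barycenter_lipschitz _ _))// (le_trans (Tk _ _))//.
  by rewrite ler_wpM2l// free_delta_lipschitz.
- rewrite (_ : free_delta 0 = 0); first by rewrite [T 0](linear0 T') [b 0](linear0 b').
  apply/normr0_eq0/le_anti; rewrite normr_ge0 andbT.
  apply: dual_norm_le => // f.
  by rewrite /= /eval_at lip0_0 normr0 mul0r.
- apply: (@finite_dim_lspan _ _ _ (b \o e)) => _ [x _ <-].
  have : range T (T (free_delta x)) by exists (free_delta x).
  rewrite eT => -[m [a [f [fe ->]]]].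
  exists m, a, (b \o f); split.
    by move=> i /=; have [j _ <-] := fe i; exists j.
  rewrite -[b _]/(b' _) linear_sum; apply: eq_bigr => i _; exact: linearZ.
Qed.

End compression.

Theorem proposition2p5 (R : realType) (X : completeNormedModType R) :
  approximation_property (lip_free X) -> lipschitz_approximation_property X.
Proof.
have [b [b_linear b_norm b_delta]] := barycenter_ex X.
rewrite /approximation_property /lipschitz_approximation_property.
rewrite /tau_c_closure !closureEcvg => -[G GF [Gid Gfr]].
pose c (T : lip_free X -> lip_free X) (x : X) := b (T (free_delta x)).
(* Closure points are limits of filters containing the set, so it suffices to
   push such a filter forward along [c]. *)
exists (c @ G); first exact: fmap_proper_filter.
split; last first.
  move=> P FP; change (G (c @^-1` P)).
  by apply: Gfr => T Tfr; apply: FP; exact: (lip0F_compress b_linear b_norm).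
apply/fam_cvgP => K cK P /=; rewrite uniform_nbhs => -[E [entE EP]].
have cdK : compact (@free_delta R X @` K).
  apply: continuous_compact => //; apply: continuous_subspaceT => x.
  apply/cvgrPdist_lt => e e0; apply/nbhs_normP; exists e => //= y.
  exact: le_lt_trans (free_delta_lipschitz _ _).
move: entE; rewrite -entourage_from_ballE => -[e /= e0 eE].
have entball : entourage [set z : lip_free X * lip_free X | ball z.1 e z.2].
  by rewrite -entourage_from_ballE; exists e.
change (G (c @^-1` P)).
apply: filterS (Gid _ (fam_nbhs _ entball cdK)) => T Tid.
apply: EP => x Kx; apply: eE => /=.
have : ball (free_delta x) e (T (free_delta x)) by apply: Tid; exists x.
rewrite -!ball_normE/= => /(le_lt_trans _); apply.
by rewrite -{1}(b_delta x); exact: barycenter_lipschitz.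
Qed.
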